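(* Let $u\in C^0(B_1)$ be a viscosity solution of $\Delta_\infty u=\mathcal{G}(x,u,Du)$ in $B_1\subset\mathbb{R}^n$ with $\|u\|_{L^\infty(B_1)}\le 1$, where $\mathcal{G}$ satisfies the structure condition stated in the context. Let $x_0\in\Gamma(u)$ and let $r_0>0$ be such that $B_{r_0}(x_0)\subset B_1$. Let $\alpha:=\frac{4-\kappa}{3-(m+\kappa)}$ and $\mathrm{C}_0>0$. If $$\sup_{B_r(x_0)}u^-\le\mathrm{C}_0r^\alpha\quad\Big(\text{resp. }\sup_{B_r(x_0)}u^+\le\mathrm{C}_0r^\alpha\Big)\quad\text{for all } r\in(0,r_0],$$ then there exists a positive constant $\mathrm{C}_1$ such that $$\sup_{B_r(x_0)}u^+\le\mathrm{C}_1r^\alpha\quad\Big(\text{resp. }\sup_{B_r(x_0)}u^-\le\mathrm{C}_1r^\alpha\Big)\quad\text{for all } r\in(0,r_0].$$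
   Context: $B_r(x_0)\subset\mathbb{R}^n$ is the open ball, $B_r=B_r(0)$; $u^+=\max\{u,0\}$, $u^-=\max\{-u,0\}$. $\Delta_\infty u=\langle D^2u\,Du,Du\rangle$. Structure condition: $\mathcal{G}:B_1\times\mathbb{R}\times\mathbb{R}^n\to\mathbb{R}$ and there is a constant $C_*>0$ with $$|\mathcal{G}(x,rt,s\xi)|\le C_*\,r^m s^\kappa|f(x)||t|^m\min\{1,|\xi|^\kappa\}\quad\text{for all } r,s\in(0,1],\ x\in B_1,\ t\in\mathbb{R},\ \xi\in\mathbb{R}^n,$$ where $f\in L^\infty(B_1)\cap C^0(B_1)$ and $(m,\kappa)\in[0,3)\times[0,4)$ satisfies $m<3-\kappa$. Viscosity solution: $u$ is a viscosity subsolution (resp. supersolution) of $\Delta_\infty u=\mathcal{G}(x,u,Du)$ if whenever $\varphi\in C^2$ and $u-\varphi$ has a local maximum (resp. minimum) at $y$, then $\Delta_\infty\varphi(y)\ge\mathcal{G}(y,u(y),D\varphi(y))$ (resp. $\le$); $u$ is a viscosity solution if it is both. $\Gamma(u):=\{u=0\}\cap\partial\{u>0\}\cap\partial\{u<0\}$ (branching points). *)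

(* Defs.v *)
From HB Require Import structures.
From mathcomp Require Import all_boot all_order all_algebra.
From mathcomp Require Import all_classical all_reals all_analysis.

Set Implicit Arguments.
Unset Strict Implicit.
Unset Printing Implicit Defensive.

Import Order.TTheory GRing.Theory Num.Theory.
Import numFieldNormedType.Exports.
Local Open Scope classical_set_scope.
Local Open Scope ring_scope.

(* The library norm on 'rV[R]_n is the max norm, so the Euclidean norm and its
   balls are defined here; both norms induce the same (library) topology. *)
Definition enorm (R : realType) (n : nat) (x : 'rV[R]_n) : R :=
  Num.sqrt (\sum_(i < n) x 0 i ^+ 2).

Definition eball (R : realType) (n : nat) (x0 : 'rV[R]_n) (r : R) :
    set 'rV[R]_n :=
  [set x | enorm (x - x0) < r].

Definition boundary (T : topologicalType) (A : set T) : set T :=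
  closure A `\` interior A.

Definition sup_on (R : realType) (T : Type) (A : set T) (g : T -> R) : \bar R :=
  ereal_sup [set (g x)%:E | x in A].

(* Only applied to functions that are continuous on an open set A, for which
   the essential supremum of the modulus is its supremum. *)
Definition Linfty_norm (R : realType) (T : Type) (A : set T) (g : T -> R) :
    \bar R :=
  sup_on A (fun x => `|g x|).

Definition partial (R : realType) (n : nat) (i : 'I_n) (phi : 'rV[R]_n -> R) :
    'rV[R]_n -> R :=
  fun x => 'D_(delta_mx 0 i) phi x.

Definition gradient (R : realType) (n : nat) (phi : 'rV[R]_n -> R)
    (x : 'rV[R]_n) : 'rV[R]_n :=
  \row_i partial i phi x.

Definition hessian (R : realType) (n : nat) (phi : 'rV[R]_n -> R)
    (x : 'rV[R]_n) : 'M[R]_n :=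
  \matrix_(i, j) partial i (partial j phi) x.

Definition dot (R : realType) (n : nat) (v w : 'rV[R]_n) : R :=
  \sum_(i < n) v 0 i * w 0 i.

(* Vectors are rows, so the image of D phi under the matrix D^2 phi is
   D phi *m (D^2 phi)^T. *)
Definition infinity_laplacian (R : realType) (n : nat) (phi : 'rV[R]_n -> R)
    (x : 'rV[R]_n) : R :=
  dot (gradient phi x *m (hessian phi x)^T) (gradient phi x).

(* phi is of class C^2 on the open set U; its values off U are irrelevant. *)
Definition C2_on (R : realType) (n : nat) (U : set 'rV[R]_n)
    (phi : 'rV[R]_n -> R) : Prop :=
  [/\ {within U, continuous phi},
      forall i, (forall x, U x -> derivable phi x (delta_mx 0 i)) /\
        {within U, continuous (partial i phi)} &
      forall i j,
        (forall x, U x -> derivable (partial j phi) x (delta_mx 0 i)) /\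
        {within U, continuous (partial i (partial j phi))}].

Definition local_max (R : realType) (T : topologicalType) (g : T -> R) (y : T) :
    Prop :=
  \forall z \near y, g z <= g y.

Definition local_min (R : realType) (T : topologicalType) (g : T -> R) (y : T) :
    Prop :=
  \forall z \near y, g y <= g z.

Definition viscosity_subsolution (R : realType) (n : nat) (U : set 'rV[R]_n)
    (G : 'rV[R]_n -> R -> 'rV[R]_n -> R) (u : 'rV[R]_n -> R) : Prop :=
  forall (phi : 'rV[R]_n -> R) (y : 'rV[R]_n),
    C2_on U phi -> U y -> local_max (u \- phi) y ->
    infinity_laplacian phi y >= G y (u y) (gradient phi y).

Definition viscosity_supersolution (R : realType) (n : nat) (U : set 'rV[R]_n)
    (G : 'rV[R]_n -> R -> 'rV[R]_n -> R) (u : 'rV[R]_n -> R) : Prop :=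
  forall (phi : 'rV[R]_n -> R) (y : 'rV[R]_n),
    C2_on U phi -> U y -> local_min (u \- phi) y ->
    infinity_laplacian phi y <= G y (u y) (gradient phi y).

Definition viscosity_solution (R : realType) (n : nat) (U : set 'rV[R]_n)
    (G : 'rV[R]_n -> R -> 'rV[R]_n -> R) (u : 'rV[R]_n -> R) : Prop :=
  viscosity_subsolution U G u /\ viscosity_supersolution U G u.

(* Real powers are taken with 0 `^ 0 = 1. *)
Definition growth_condition (R : realType) (n : nat) (U : set 'rV[R]_n)
    (Cstar m kappa : R) (f : 'rV[R]_n -> R)
    (G : 'rV[R]_n -> R -> 'rV[R]_n -> R) : Prop :=
  forall (r s : R) (x : 'rV[R]_n) (t : R) (xi : 'rV[R]_n),
    0 < r <= 1 -> 0 < s <= 1 -> U x ->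
    `|G x (r * t) (s *: xi)| <=
      Cstar * r `^ m * s `^ kappa * `|f x| * `|t| `^ m *
      Num.min 1 (enorm xi `^ kappa).

(* The domain of u is U: values of u off U play no role. *)
Definition branching_points (R : realType) (n : nat) (U : set 'rV[R]_n)
    (u : 'rV[R]_n -> R) : set 'rV[R]_n :=
  [set x | U x /\ u x = 0] `&`
  boundary [set x | U x /\ 0 < u x] `&`
  boundary [set x | U x /\ u x < 0].

(* Main.v *)
Require Import Defs.
From HB Require Import structures.
From mathcomp Require Import all_boot all_order all_algebra.
From mathcomp Require Import all_classical all_reals all_analysis.
From mathcomp Require Import ring lra.

Import Order.TTheory GRing.Theory Num.Theory.
Import numFieldNormedType.Exports.
Local Open Scope classical_set_scope.
Local Open Scope ring_scope.

Set Implicit Arguments.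
Unset Strict Implicit.
Unset Printing Implicit Defensive.

(** Two facts about the equation carry the theorem.

First, the structure condition reduces to a bound on G in terms of u alone.
Writing xi = s (xi / s) gives [|G x t xi| <= C s^kappa |t|^m] for every s
in (0, 1]: if kappa > 0, letting s tend to 0 shows that G vanishes, and if
kappa = 0 the bound reads [|G x t xi| <= K |t|^m].  In both cases
[|Delta_oo u| <= K |u|^m] with either K = 0 or 4 + alpha m = 3 alpha, the
second relation being the scaling invariance of this inequality under
u |-> u(r x) / r^alpha.

Secondly, a supersolution satisfies a Harnack inequality, obtained by comparison
from below with the perturbed cone [v y - a rho + a rho^2 / (4 r)], where rho is
the distance to y ([cone_barrier]).  On a ball of radius r the infinity
Laplacian of the cone is at least a^3 / (16 r), so the cone cannot touch v from
below off its vertex when a^3 exceeds [16 r sup K |v|^m].  Choosing the smallest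
slope a for which the cone lies below L <= v on the sphere yields
[v y - L <= C (v x - L)] or [(v y - L)^3 <= C r^4 sup K |v|^m] whenever x is
within r / 2 of y ([supersolution_harnack]).

Now let v = u or v = - u, so that v x0 = 0, and let v >= - C0 r^alpha on every
ball of radius r about x0.  With x = x0 and L = - C0 (4 r)^alpha, the first
alternative bounds v y by a multiple of r^alpha.  In the second one, a bound
[|v| <= C1 (4 r)^alpha] on the ball of radius 4 r gives
[(v y)^3 <= C K C1^m r^(3 alpha)], which is at most (C1 r^alpha)^3 for C1 large,
because m < 3.  So the bound propagates from radius 4 r to radius r, and
induction on the scale, started from [|v| <= 1], gives it for all r
([one_sided_growth]). *)

(** * Euclidean distance *)

Lemma dotE (R : realType) (n : nat) (v : 'rV[R]_n) :
  dot v v = \sum_(i < n) v 0 i ^+ 2.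
Proof. by apply: eq_bigr => i _; rewrite expr2. Qed.

Lemma dot_ge0 (R : realType) (n : nat) (v : 'rV[R]_n) : 0 <= dot v v.
Proof. by rewrite dotE sumr_ge0// => i _; exact: sqr_ge0. Qed.

Lemma enorm_ge0 (R : realType) (n : nat) (v : 'rV[R]_n) : 0 <= enorm v.
Proof. exact: sqrtr_ge0. Qed.

Lemma sqr_enorm (R : realType) (n : nat) (v : 'rV[R]_n) :
  enorm v ^+ 2 = dot v v.
Proof. by rewrite /enorm -dotE sqr_sqrtr// dot_ge0. Qed.

Lemma enorm_eq0 (R : realType) (n : nat) (v : 'rV[R]_n) : enorm v = 0 -> v = 0.
Proof.
move=> v0; have : dot v v == 0 by rewrite -sqr_enorm v0 expr0n.
rewrite dotE psumr_eq0 => [/allP v2|i _]; last exact: sqr_ge0.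
apply/rowP => i; rewrite mxE; apply/eqP; rewrite -sqrf_eq0.
by apply: v2; rewrite mem_index_enum.
Qed.

Lemma continuous_sqdist (R : realType) (n : nat) (y : 'rV[R]_n) :
  continuous (fun x : 'rV[R]_n => dot (x - y) (x - y)).
Proof.
move=> x; rewrite (_ : (fun x => _) =
  \sum_(i < n) (fun x : 'rV[R]_n => (x 0 i - y 0 i) ^+ 2)); last first.
  apply/funext => z; rewrite dotE fct_sumE.
  by apply: eq_bigr => i _; rewrite !mxE.
apply: big_ind => [|f g cf cg|i _]; first exact: (@cst_continuous _ _ 0).
  exact: continuousD.
apply: (@continuous_comp _ _ _ (fun x : 'rV[R]_n => x 0 i)
  (fun t : R => (t - y 0 i) ^+ 2)); first exact: coord_continuous.
apply: (@continuous_comp _ _ _ (fun t : R => t - y 0 i) (fun t : R => t ^+ 2)).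
  by apply: (@continuousB _ _ _ id (cst (y 0 i))) => //; exact: cst_continuous.
exact: exprn_continuous.
Qed.

Lemma continuous_enormB (R : realType) (n : nat) (y : 'rV[R]_n) :
  continuous (fun x : 'rV[R]_n => enorm (x - y)).
Proof.
move=> x; rewrite (_ : (fun x => _) =
  Num.sqrt \o (fun x : 'rV[R]_n => dot (x - y) (x - y))); last first.
  by apply/funext => z /=; rewrite dotE.
apply: continuous_comp; first exact: continuous_sqdist.
exact: sqrt_continuous.
Qed.

Lemma compact_closed_eball (R : realType) (n : nat) (y : 'rV[R]_n) (r : R) :
  compact [set x : 'rV[R]_n | enorm (x - y) <= r].
Proof.
pose cube := [set x : 'rV[R]_n |
  forall i, x ord0 i \in `[y 0 i - r, y 0 i + r] ].
have cc : compact cube.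
  apply: (@rV_compact _ _ (fun i => `[y 0 i - r, y 0 i + r]%classic)).
  by move=> i; exact: segment_compact.
apply: subclosed_compact cc _.
  rewrite (_ : mkset _ =
    (fun x : 'rV[R]_n => enorm (x - y)) @^-1` [set t | t <= r])//.
  by apply: closed_comp; [move=> x _; exact: continuous_enormB|exact: closed_le].
move=> x /= xr i; rewrite in_itv/= -ler_distl.
have r0 : 0 <= r := le_trans (enorm_ge0 _) xr.
rewrite -(@ler_pXn2r _ 2)// ?nnegrE// real_normK ?num_real//.
apply: (@le_trans _ _ (enorm (x - y) ^+ 2)); last first.
  by rewrite ler_pXn2r ?nnegrE ?enorm_ge0.
rewrite sqr_enorm dotE (bigD1 i)//= !mxE lerDl sumr_ge0// => j _.
exact: sqr_ge0.
Qed.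

(** The factor 4 instead of the optimal 3 leaves enough room for a termwise use of
[(a + b)^2 <= 2 a^2 + 2 b^2], so that the Cauchy-Schwarz inequality is avoided. *)
Lemma eball_triangle (R : realType) (n : nat) (x y z : 'rV[R]_n) (r : R) :
  enorm (y - x) < r -> enorm (z - y) <= 2 * r -> enorm (z - x) < 4 * r.
Proof.
move=> yx zy; have r0 : 0 < r := le_lt_trans (enorm_ge0 _) yx.
rewrite -(@ltr_pXn2r _ 2)// ?nnegrE ?enorm_ge0//; last by rewrite mulr_ge0// ltW.
have {}yx : enorm (y - x) ^+ 2 < r ^+ 2.
  by rewrite ltr_pXn2r ?nnegrE ?enorm_ge0// ltW.
have {}zy : enorm (z - y) ^+ 2 <= (2 * r) ^+ 2.
  by rewrite ler_pXn2r ?nnegrE ?enorm_ge0// mulr_ge0// ltW.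
suff : enorm (z - x) ^+ 2 <= 2 * enorm (y - x) ^+ 2 + 2 * enorm (z - y) ^+ 2.
  by rewrite !exprMn in zy *; nra.
rewrite !sqr_enorm !dotE !mulr_sumr -big_split/=.
apply: ler_sum => i _; rewrite !mxE.
have := sqr_ge0 (z 0 i - y 0 i - (y 0 i - x 0 i)); nra.
Qed.

(** * Radial quartic test functions *)

(** Test functions have to be C^2 on the whole domain, which excludes cones because
of their vertex.  These polynomials are smooth everywhere and flexible enough:
at a point with squared distance q to y their radial slope and curvature can be
prescribed arbitrarily.  The family is closed under negation, which lets
subsolutions and supersolutions share it. *)
Definition radial_quartic (R : realType) (n : nat) (y : 'rV[R]_n)
    (q c1 c2 : R) (x : 'rV[R]_n) : R :=
  c1 * (dot (x - y) (x - y) - q) + c2 * (dot (x - y) (x - y) - q) ^+ 2.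

Lemma is_derive_coord (R : realType) (n : nat) (i : 'I_n) (x v : 'rV[R]_n) :
  is_derive x v (fun z : 'rV[R]_n => z 0 i) (v 0 i).
Proof.
have cv : (fun h => h^-1 *: (((fun z : 'rV[R]_n => z 0 i) \o shift x) (h *: v)
    - x 0 i)) @ 0^' --> v 0 i.
  apply: (@cvg_trans _ (cst (v 0 i) @ (0 : R)^')); last exact: cvg_cst.
  apply: near_eq_cvg; near=> h.
  rewrite /= !mxE addrK scalerA mulVf ?scale1r//.
  by near: h; exact: nbhs_dnbhs_neq.
by split; [apply/cvg_ex; exists (v 0 i)|exact/cvg_lim].
Unshelve. all: by end_near. Qed.

Lemma is_derive_coordB (R : realType) (n : nat) (y : 'rV[R]_n) (i j : 'I_n)
    (x : 'rV[R]_n) :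
  is_derive x (delta_mx 0 i) (fun z : 'rV[R]_n => z 0 j - y 0 j)
    ((i == j)%:R).
Proof.
apply: is_derive_eq; first exact: (is_deriveB (is_derive_coord _ _ _)).
by rewrite subr0 mxE eqxx/= eq_sym.
Qed.

Lemma is_derive_sqdist (R : realType) (n : nat) (y : 'rV[R]_n) (i : 'I_n)
    (x : 'rV[R]_n) :
  is_derive x (delta_mx 0 i) (fun z : 'rV[R]_n => dot (z - y) (z - y))
    (2 * (x 0 i - y 0 i)).
Proof.
rewrite (_ : (fun z => _) =
  \sum_(k < n) ((fun z : 'rV[R]_n => z 0 k - y 0 k) ^+ 2)); last first.
  apply/funext => z; rewrite dotE fct_sumE.
  by apply: eq_bigr => k _; rewrite !mxE.
apply: is_derive_eq.
  by apply: is_derive_sum => k; apply: is_deriveX; exact: is_derive_coordB.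
rewrite (bigD1 i)//= big1 => [|k /negPf ki].
  by rewrite eqxx addr0 expr1 /GRing.scale/= mulr1.
by rewrite eq_sym ki scaler0.
Qed.

Section quartic.
Context (R : realType) (n : nat) (y : 'rV[R]_n) (q c1 c2 : R).
Local Notation phi := (radial_quartic y q c1 c2).
Local Notation N := (fun x : 'rV[R]_n => dot (x - y) (x - y) - q).

Let is_derive_N i x : is_derive x (delta_mx 0 i) N (2 * (x 0 i - y 0 i)).
Proof.
apply: is_derive_eq; first exact: (is_deriveB (is_derive_sqdist _ _ _)).
by rewrite subr0.
Qed.

Lemma is_derive_radial_quartic i x :
  is_derive x (delta_mx 0 i) phi
    (2 * (c1 + 2 * c2 * (dot (x - y) (x - y) - q)) * (x 0 i - y 0 i)).
Proof.
rewrite (_ : phi = c1 *: N + c2 *: (N ^+ 2)); last exact/funext.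
have dN := is_derive_N i x.
apply: (is_derive_eq (is_deriveD (is_deriveZ c1 dN)
  (is_deriveZ c2 (is_deriveX 2 dN)))).
by rewrite /GRing.scale/= expr1; ring.
Qed.

Lemma partial_radial_quartic i : partial i phi = fun x =>
  2 * (c1 + 2 * c2 * (dot (x - y) (x - y) - q)) * (x 0 i - y 0 i).
Proof.
by apply/funext => x; have [_] := is_derive_radial_quartic i x.
Qed.

Lemma is_derive_partial_radial_quartic i j x :
  is_derive x (delta_mx 0 i) (partial j phi)
    (8 * c2 * (x 0 i - y 0 i) * (x 0 j - y 0 j) +
     2 * (c1 + 2 * c2 * (dot (x - y) (x - y) - q)) * (i == j)%:R).
Proof.
rewrite partial_radial_quartic (_ : (fun x => _) =
    (cst (2 * c1) + (4 * c2) *: N) * (fun x : 'rV[R]_n => x 0 j - y 0 j));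
    last first.
  apply/funext => z.
  rewrite -[RHS]/((2 * c1 + 4 * c2 * (dot (z - y) (z - y) - q)) *
    (z 0 j - y 0 j)).
  by ring.
have dA := is_deriveD (is_derive_cst (2 * c1) x (delta_mx 0 i))
  (is_deriveZ (4 * c2) (is_derive_N i x)).
apply: (is_derive_eq (is_deriveM dA (is_derive_coordB y i j x))).
rewrite -[LHS]/((2 * c1 + 4 * c2 * (dot (x - y) (x - y) - q)) * (i == j)%:R +
  (x 0 j - y 0 j) * (0 + 4 * c2 * (2 * (x 0 i - y 0 i)))).
by ring.
Qed.

Lemma partial2_radial_quartic i j : partial i (partial j phi) = fun x =>
  8 * c2 * (x 0 i - y 0 i) * (x 0 j - y 0 j) +
     2 * (c1 + 2 * c2 * (dot (x - y) (x - y) - q)) * (i == j)%:R.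
Proof.
by apply/funext => x; have [_] := is_derive_partial_radial_quartic i j x.
Qed.

Let cN : continuous N.
Proof.
move=> x.
exact: (continuousB (@continuous_sqdist _ _ y x) (@cst_continuous _ _ q x)).
Qed.

Let cC i : continuous (fun x : 'rV[R]_n => x 0 i - y 0 i).
Proof.
move=> x.
exact: (continuousB (@coord_continuous _ _ _ 0 i x)
  (@cst_continuous _ _ (y 0 i) x)).
Qed.

Let cZ (k : R) (g : 'rV[R]_n -> R) : continuous g ->
  continuous (fun x => k * g x).
Proof. by move=> cg x; exact: (continuousM (@cst_continuous _ _ k x) (cg x)). Qed.

Lemma C2_radial_quartic U : C2_on U phi.
Proof.
have cA : continuous (fun x => 2 * (c1 + 2 * c2 * N x)).
  apply: (@cZ 2 (fun x => c1 + 2 * c2 * N x)) => x.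
  exact: (continuousD (@cst_continuous _ _ c1 x) (@cZ (2 * c2) _ cN x)).
split=> [|i|i j].
- apply: continuous_subspaceT => x.
  have cN2 : continuous (fun z => N z ^+ 2).
    move=> z; apply: (@continuous_comp _ _ _ N (fun t : R => t ^+ 2)).
      exact: cN.
    exact: exprn_continuous.
  exact: (continuousD (@cZ c1 _ cN x) (@cZ c2 _ cN2 x)).
- split=> [x _|]; first by have [] := is_derive_radial_quartic i x.
  apply: continuous_subspaceT; rewrite partial_radial_quartic => x.
  exact: (continuousM (cA x) (@cC i x)).
split=> [x _|]; first by have [] := is_derive_partial_radial_quartic i j x.
apply: continuous_subspaceT; rewrite partial2_radial_quartic => x.
have c8 := continuousM (@cZ (8 * c2) _ (@cC i) x) (@cC j x).
exact: (continuousD c8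
  (continuousM (cA x) (@cst_continuous _ _ ((i == j)%:R : R) x))).
Qed.

Lemma infinity_laplacian_radial_quartic z : dot (z - y) (z - y) = q ->
  infinity_laplacian phi z = 4 * c1 ^+ 2 * q * (2 * c1 + 8 * c2 * q).
Proof.
move=> zq; rewrite /infinity_laplacian /dot.
have gE k : gradient phi z 0 k = 2 * c1 * (z - y) 0 k.
  by rewrite !mxE partial_radial_quartic zq subrr mulr0 addr0.
have HE i : (gradient phi z *m (hessian phi z)^T) 0 i =
    2 * c1 * (2 * c1 + 8 * c2 * q) * (z - y) 0 i.
  transitivity (\sum_j (2 * c1 * 8 * c2 * (z - y) 0 i * (z - y) 0 j ^+ 2 +
      4 * c1 ^+ 2 * (z - y) 0 j * (i == j)%:R)).
    rewrite mxE; apply: eq_bigr => j _; rewrite gE !mxE.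
    by rewrite partial2_radial_quartic zq subrr mulr0 addr0; ring.
  rewrite big_split/= -mulr_sumr -dotE zq (bigD1 i)//= big1 => [|j /negPf].
    by rewrite eqxx mulr1; ring.
  by rewrite eq_sym => ->; rewrite mulr0.
under eq_bigr do rewrite HE gE.
transitivity (4 * c1 ^+ 2 * (2 * c1 + 8 * c2 * q) *
    \sum_i (z - y) 0 i ^+ 2).
  by rewrite mulr_sumr; apply: eq_bigr => i _; ring.
by rewrite -dotE zq; ring.
Qed.
End quartic.

(** * Comparison with cones *)

(** This is the viscosity inequality [Delta_oo v <= K |v|^m], tested only against
radial quartics; the left-hand side is their infinity Laplacian at z.  It holds
for u and for - u alike, whence the symmetry of the theorem. *)
Definition quartic_supersolution (R : realType) (n : nat) (U : set 'rV[R]_n)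
    (K m : R) (v : 'rV[R]_n -> R) : Prop :=
  forall (y z : 'rV[R]_n) (c1 c2 : R),
    let q := dot (z - y) (z - y) in
    U z -> (\forall x \near z, v z <= v x - radial_quartic y q c1 c2 x) ->
    4 * c1 ^+ 2 * q * (2 * c1 + 8 * c2 * q) <= K * `|v z| `^ m.

(** At radius s the quartic in t is tangent to the cone [- a t + b t^2] and has
radial second derivative b, half of that of the cone; hence it stays below
the cone near s.  Beyond s the quartic may catch up, but not before t - s
reaches [b / (8 d c2)]. *)
Lemma cone_bends_above_quartic (R : realType) (a b c1 c2 s t d : R) :
  0 < s -> 0 <= t -> 0 <= c2 -> s <= d -> t <= d ->
  c1 * (2 * s) = - a + 2 * b * s -> c2 * (4 * s ^+ 2) = b / 2 - c1 ->
  0 <= b -> (t - s) * (8 * d * c2) <= b ->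
  c1 * (t ^+ 2 - s ^+ 2) + c2 * (t ^+ 2 - s ^+ 2) ^+ 2 <=
    (- a * t + b * t ^+ 2) - (- a * s + b * s ^+ 2).
Proof.
move=> s0 t0 c20 sd td c1E c2E b0 h; rewrite -subr_ge0.
have -> : - a * t + b * t ^+ 2 - (- a * s + b * s ^+ 2) -
    (c1 * (t ^+ 2 - s ^+ 2) + c2 * (t ^+ 2 - s ^+ 2) ^+ 2) =
    (t - s) ^+ 2 * (b / 2 - c2 * (t - s) * (t + 3 * s)).
  transitivity ((t - s) ^+ 2 * (b - c1 - c2 * (4 * s ^+ 2) -
      c2 * (t - s) * (t + 3 * s)) + (t - s) * (- a + 2 * b * s - c1 * (2 * s))).
    by ring.
  by rewrite c1E c2E; field.
apply: mulr_ge0; first exact: sqr_ge0.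
rewrite subr_ge0; have [ts|st] := leP t s.
  have : 0 <= c2 * (s - t) * (t + 3 * s).
    by rewrite !mulr_ge0 ?subr_ge0// addr_ge0// mulr_ge0// ltW.
  by lra.
have h1 : 0 <= c2 * (t - s) by rewrite mulr_ge0// subr_ge0 ltW.
have : c2 * (t - s) * (t + 3 * s) <= c2 * (t - s) * (4 * d).
  by apply: ler_wpM2l => //; lra.
by move: h; lra.
Qed.

(** With rho the distance to y, [v + a rho - a rho^2 / (4 r)] attains its minimum
over the closed ball.  The minimum equals [v y] if attained at the vertex, and is
at least [v y] on the sphere, where the cone has dropped by 3/4 a r; in between,
the quartic of [cone_bends_above_quartic] would touch v from below, with an
infinity Laplacian of at least a^3 / (16 r), which is excluded. *)
Lemma cone_barrier (R : realType) (n : nat) (U : set 'rV[R]_n) (K m : R)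
    (v : 'rV[R]_n -> R) (y : 'rV[R]_n) (r a L : R) :
  quartic_supersolution U K m v -> {within U, continuous v} ->
  0 < r -> 0 < a ->
  (forall x, enorm (x - y) <= r -> U x) ->
  (forall x, enorm (x - y) <= r -> L <= v x) ->
  (forall x, enorm (x - y) <= r -> K * `|v x| `^ m < a ^+ 3 / (16 * r)) ->
  v y - 3 / 4 * a * r <= L ->
  forall x, enorm (x - y) <= r ->
    v y - a * enorm (x - y) + a / (4 * r) * enorm (x - y) ^+ 2 <= v x.
Proof.
move=> sv cv r0 a0 BU BL BM vyL.
set b := a / (4 * r).
pose H (t : R) := - a * t + b * t ^+ 2.
pose g (x : 'rV[R]_n) := v x - H (enorm (x - y)).
have b0 : 0 < b by rewrite divr_gt0// mulr_gt0.
have bE : b * (4 * r) = a by rewrite divfK// gt_eqF// mulr_gt0.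
have cH : continuous (fun x : 'rV[R]_n => H (enorm (x - y))).
  move=> x; apply: (@continuous_comp _ _ _ (fun x : 'rV[R]_n => enorm (x - y)) H).
    exact: continuous_enormB.
  apply: (@continuousD _ _ _ (fun t => - a * t) (fun t => b * t ^+ 2)).
    exact: mulrl_continuous.
  move: (enorm _) => t.
  exact: (continuousM (@cst_continuous R R b t) (@exprn_continuous R 2 t)).
have cg : {within [set x : 'rV[R]_n | enorm (x - y) <= r], continuous g}.
  have c1 : {within [set x : 'rV[R]_n | enorm (x - y) <= r], continuous v}.
    exact: continuous_subspaceW cv.
  have c2 := continuous_subspaceT
    (A := [set x : 'rV[R]_n | enorm (x - y) <= r]) cH.
  by move=> x; exact: (continuousB (c1 x) (c2 x)).
have yy : enorm (y - y) = 0.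
  by rewrite /enorm subrr big1 ?sqrtr0// => i _; rewrite mxE expr0n.
have ne : [set x : 'rV[R]_n | enorm (x - y) <= r] !=set0.
  by exists y; rewrite /= yy ltW.
have [z /set_mem/= zr zmin] :=
  compact_EVT_min ne (@compact_closed_eball R n y r) cg.
suff vyz : v y <= g z.
  move=> x xr; have := zmin x (mem_set xr).
  by move/(le_trans vyz); rewrite /g /H; lra.
set s := enorm (z - y) in zr.
have [s0|s0] := leP s 0.
  have : s = 0 by apply/eqP; rewrite eq_le s0 enorm_ge0.
  move=> {}s0; rewrite /g -/s s0 /H.
  by move/enorm_eq0/subr0_eq : s0 => ->; lra.
have [rs|sr] := leP r s.
  have sE : s = r by apply/le_anti; rewrite zr rs.
  rewrite /g -/s sE /H; have := BL z zr.
  suff : b * r ^+ 2 = a * r / 4 by lra.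
  by rewrite -bE; field.
exfalso.
(* c1 matches the slope of the cone at s; c2 is then fixed by requiring the
   radial second derivative 2 c1 + 8 c2 s^2 to equal b, half of that of the
   cone: the gap makes the contact strict to second order, while b is still
   large enough for the contradiction. *)
pose c1 := (- a + 2 * b * s) / (2 * s).
pose c2 := (b / 2 - c1) / (4 * s ^+ 2).
have c1E : c1 * (2 * s) = - a + 2 * b * s.
  by rewrite divfK// gt_eqF// mulr_gt0.
have c2E : c2 * (4 * s ^+ 2) = b / 2 - c1.
  by rewrite divfK// gt_eqF// mulr_gt0// exprn_gt0.
have slope : - a + 2 * b * s <= - a / 2.
  suff : b * s <= b * r by lra.
  by rewrite ler_pM2l// ltW.
have c10 : c1 < 0.
  have : c1 * (2 * s) < 0 by rewrite c1E; lra.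
  by rewrite pmulr_llt0// mulr_gt0.
have c20 : 0 < c2 by rewrite divr_gt0 ?mulr_gt0 ?exprn_gt0//; lra.
clearbody c1 c2.
have qE : dot (z - y) (z - y) = s ^+ 2 by rewrite -sqr_enorm.
have zU := BU z (ltW sr).
have := sv y z c1 c2 zU; rewrite /= qE => test.
have {}test : 4 * c1 ^+ 2 * s ^+ 2 * (2 * c1 + 8 * c2 * s ^+ 2) <=
    K * `|v z| `^ m.
  apply: test.
  have d0 : 0 < 8 * r * c2 by rewrite !mulr_gt0//.
  have e0 : 0 < b / (8 * r * c2) by rewrite divr_gt0.
  have lt1 : s < Num.min r (s + b / (8 * r * c2)).
    by rewrite lt_min sr ltrDl e0.
  have close := cvgr_lt s (@continuous_enormB R n y z) _ lt1.
  near=> x.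
  have : enorm (x - y) < Num.min r (s + b / (8 * r * c2)).
    by near: x; exact: close.
  rewrite lt_min => /andP[xr xs].
  have := zmin x (mem_set (ltW xr)).
  have := @cone_bends_above_quartic R a b c1 c2 s (enorm (x - y)) r s0
    (enorm_ge0 _) (ltW c20) (ltW sr) (ltW xr) c1E c2E (ltW b0).
  rewrite -ler_pdivlMr// lerBlDl => /(_ (ltW xs)).
  by rewrite /g /H -/s /radial_quartic -sqr_enorm; lra.
have := BM z (ltW sr); apply/negP; rewrite -leNgt; apply: le_trans test.
have -> : 4 * c1 ^+ 2 * s ^+ 2 * (2 * c1 + 8 * c2 * s ^+ 2) =
    (c1 * (2 * s)) ^+ 2 * (2 * (c1 + c2 * (4 * s ^+ 2))) by ring.
rewrite c1E c2E.
have -> : a ^+ 3 / (16 * r) = (a / 2) ^+ 2 * b by rewrite /b; field; rewrite gt_eqF.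
have -> : 2 * (c1 + (b / 2 - c1)) = b by field.
by rewrite ler_pM2r//; nra.
Unshelve. all: by end_near. Qed.

(** Comparison with the cone of slope [a = 4 (v y - L) / (3 r)], the smallest for
which it falls below L on the sphere; it still exceeds L by 5/12 of [v y - L] at
distance r / 2.  The second alternative is the case where this slope is too
small for the right-hand side of the equation. *)
Lemma supersolution_harnack (R : realType) (n : nat) (U : set 'rV[R]_n)
    (K m : R) (v : 'rV[R]_n -> R) (x y : 'rV[R]_n) (r L M : R) :
  quartic_supersolution U K m v -> {within U, continuous v} -> 0 < r ->
  (forall z, enorm (z - y) <= r -> U z) ->
  (forall z, enorm (z - y) <= r -> L <= v z) ->
  (forall z, enorm (z - y) <= r -> K * `|v z| `^ m <= M) ->
  enorm (x - y) <= r / 2 ->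
  v y - L <= 12 / 5 * (v x - L) \/ (v y - L) ^+ 3 <= 27 / 4 * r ^+ 4 * M.
Proof.
move=> sv cv r0 BU BL BM xy.
have xr : enorm (x - y) <= r by lra.
have [vyL|Lvy] := leP (v y) L; first by left; have := BL x xr; lra.
pose a := 4 / 3 * (v y - L) / r.
have aE : a * r = 4 / 3 * (v y - L) by rewrite divfK// gt_eqF.
have a0 : 0 < a by rewrite divr_gt0// mulr_gt0// subr_gt0.
have [Ma|aM] := ltP M (a ^+ 3 / (16 * r)); [left|right].
  have := @cone_barrier R n U K m v y r a L sv cv r0 a0 BU BL.
  move=> /(_ (fun z zr => le_lt_trans (BM z zr) Ma)).
  have vyL : v y - 3 / 4 * a * r <= L by rewrite -mulrA aE; lra.
  move=> /(_ vyL x xr).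
  set t := enorm (x - y) in xy *.
  have t0 : 0 <= t := enorm_ge0 _.
  have bE : a / (4 * r) * (4 * r) = a by rewrite divfK// gt_eqF// mulr_gt0.
  have b0 : 0 <= a / (4 * r).
    by apply: divr_ge0; [exact: ltW|rewrite mulr_ge0// ltW].
  move: (a / (4 * r)) bE b0 => b bE b0.
  (* The loss a t - b t^2 along the cone is increasing on [0, r / 2], where it
     is therefore at most 7 / 16 a r, its value at r / 2. *)
  have : 0 <= b * ((r / 2 - t) * (7 / 2 * r - t)).
    by rewrite mulr_ge0// mulr_ge0//; lra.
  have -> : b * ((r / 2 - t) * (7 / 2 * r - t)) =
      7 / 16 * (b * (4 * r) * r) - b * (4 * r) * t + b * t ^+ 2 by field.
  by rewrite bE aE; lra.
move: aM; rewrite ler_pdivrMr ?mulr_gt0// => aM.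
have -> : v y - L = 3 / 4 * (a * r) by rewrite aE; field.
have -> : (3 / 4 * (a * r)) ^+ 3 = 27 / 64 * r ^+ 3 * a ^+ 3 by field.
have -> : 27 / 4 * r ^+ 4 * M = 27 / 64 * r ^+ 3 * (M * (16 * r)) by field.
by rewrite ler_pM2l// !mulr_gt0// ?exprn_gt0//; lra.
Qed.
(** * Propagation of the growth bound over scales *)

Lemma powR_le_base (R : realType) (e x y : R) :
  0 <= e -> 0 <= x -> x <= y -> x `^ e <= y `^ e.
Proof.
move=> e0 x0 xy; apply: (ge0_ler_powR e0) => //; rewrite nnegrE//.
exact: le_trans xy.
Qed.

(** The term of the equation grows like [C^m] with m < 3, hence a large C absorbs it
into [C^3]. *)
Lemma growth_constant (R : realType) (m B0 B1 : R) : m < 3 -> 0 <= B1 ->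
  exists C : R, [/\ 0 < C, B0 <= C & B1 * C `^ m <= C ^+ 3].
Proof.
move=> m3 B10.
pose C := Num.max 1 (Num.max B0 (B1 `^ (3 - m)^-1)).
have C0 : 0 < C by rewrite lt_max ltr01.
exists C; split=> //; first by rewrite !le_max lexx orbT.
have BC : B1 `^ (3 - m)^-1 <= C by rewrite !le_max lexx !orbT.
have -> : C ^+ 3 = C `^ (3 - m) * C `^ m.
  rewrite -powRD; last by apply/implyP => _; rewrite gt_eqF.
  by rewrite subrK powR_mulrn// ltW.
apply: ler_wpM2r; first exact: powR_ge0.
have m30 : 3 - m != 0 by rewrite subr_eq0 gt_eqF.
have -> : B1 = (B1 `^ (3 - m)^-1) `^ (3 - m).
  by rewrite -powRrM mulVf// powRr1.
by apply: powR_le_base; rewrite ?powR_ge0// subr_ge0 ltW.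
Qed.

(** The bound for radius 4 r implies the one for radius r: the Harnack inequality is
applied in balls of radius 2 r centred at points of the ball of radius r, all of
which stay in the ball of radius 4 r about x0. *)
Lemma one_sided_growth (R : realType) (n : nat) (U : set 'rV[R]_n)
    (K m alpha : R) (v : 'rV[R]_n -> R) (x0 : 'rV[R]_n) (r0 C0 : R) :
  quartic_supersolution U K m v -> {within U, continuous v} ->
  0 <= m < 3 -> 0 <= K -> 0 <= alpha ->
  K = 0 \/ 4 + alpha * m = 3 * alpha ->
  0 < r0 -> eball x0 r0 `<=` U -> v x0 = 0 -> (forall x, U x -> `|v x| <= 1) ->
  0 < C0 ->
  (forall r, 0 < r <= r0 -> forall x, eball x0 r x -> - (C0 * r `^ alpha) <= v x) ->
  exists C1 : R, 0 < C1 /\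
    forall r, 0 < r <= r0 -> forall x, eball x0 r x -> v x <= C1 * r `^ alpha.
Proof.
move=> sv cv /andP[m0 m3] K0 al0 Kal r00 BU vx0 v1 C00 low.
pose D : R := 4 `^ alpha.
have D0 : 0 < D by rewrite powR_gt0.
pose P := (r0 / 4) `^ alpha.
have P0 : 0 < P by rewrite powR_gt0// divr_gt0.
have B10 : 0 <= 27 / 4 * 2 ^+ 4 * K * D `^ m.
  by rewrite !mulr_ge0 ?powR_ge0// exprn_ge0.
have [C1 [C10 B0C C1m]] := @growth_constant R m
  (Num.max C0 (Num.max P^-1 (12 / 5 * C0 * D))) _ m3 B10.
move: B0C; rewrite !ge_max => /and3P[C0C PC DC].
exists C1; split=> //.
suff main k : forall r, r0 <= r * 4 ^+ k -> 0 < r <= r0 ->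
    forall x, eball x0 r x -> v x <= C1 * r `^ alpha.
  move=> r /[dup] rr /andP[r_gt0 _]; apply: (main (Num.trunc (r0 / r)).+1) => //.
  rewrite mulrC -ler_pdivrMr//.
  have /ltW/le_trans : r0 / r < (Num.trunc (r0 / r)).+1%:R by exact: truncnS_gt.
  apply; rewrite -natrX ler_nat; exact/ltnW/ltn_expl.
have base r : r0 <= r * 4 -> 0 < r <= r0 ->
    forall x, eball x0 r x -> v x <= C1 * r `^ alpha.
  move=> r4 /andP[r_gt0 rr0] x xr.
  have /v1 : U x by apply: BU; exact: lt_le_trans xr rr0.
  rewrite ler_norml => /andP[_ /le_trans]; apply.
  have Pr : P <= r `^ alpha.
    by apply: powR_le_base => //; lra.
  apply: (@le_trans _ _ (C1 * P)); last by rewrite ler_pM2l.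
  by rewrite -ler_pdivrMr// mul1r.
elim: k => [|k IH] r.
  by rewrite expr0 mulr1 => rr0 /[dup] rr /andP[_ _]; apply: base => //; lra.
have [r4 _|r4 rk] := leP r0 (4 * r); first by apply: base; rewrite mulrC.
move=> /andP[r_gt0 rr0] y yr.
have r4b : 0 < 4 * r <= r0 by rewrite mulr_gt0//= ltW.
have rk4 : r0 <= 4 * r * 4 ^+ k by rewrite (mulrC 4) -mulrA -exprS.
pose p := r `^ alpha.
have p0 : 0 < p by rewrite powR_gt0.
have DpE : (4 * r) `^ alpha = D * p by rewrite powRM// ltW.
have far z : enorm (z - y) <= 2 * r -> eball x0 (4 * r) z.
  exact: eball_triangle yr.
have lowL z : enorm (z - y) <= 2 * r -> - (C0 * (D * p)) <= v z.
  by move/far; rewrite -DpE; exact: low.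
have up z : enorm (z - y) <= 2 * r -> v z <= C1 * (D * p).
  by move/far; rewrite -DpE; exact: IH.
have Uz z : enorm (z - y) <= 2 * r -> U z.
  move/far => zr; apply: BU; apply: lt_le_trans zr _.
  by move/andP : r4b => [].
have vM z : enorm (z - y) <= 2 * r ->
    K * `|v z| `^ m <= K * (C1 * (D * p)) `^ m.
  move=> zr; apply: ler_wpM2l => //.
  have DpC : C0 * (D * p) <= C1 * (D * p) by rewrite ler_pM2r// mulr_gt0.
  apply: powR_le_base => //.
  rewrite ler_norml up// andbT.
  by apply: le_trans (lowL _ zr); rewrite lerN2.
have xy : enorm (x0 - y) <= 2 * r / 2.
  rewrite mulrAC divff// mul1r; apply: ltW.
  rewrite (_ : enorm _ = enorm (y - x0))// /enorm; congr Num.sqrt.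
  by apply: eq_bigr => i _; rewrite !mxE -sqrrN opprB.
have r20 : 0 < 2 * r by rewrite mulr_gt0.
have L0 : 0 <= C0 * (D * p) by rewrite !mulr_ge0// ltW.
have := supersolution_harnack sv cv r20 Uz lowL vM xy.
rewrite vx0 opprK add0r => -[h|h].
  have : v y <= 12 / 5 * C0 * D * p by lra.
  by move/le_trans; apply; rewrite ler_pM2r.
suff : v y + C0 * (D * p) <= C1 * p by rewrite -/p; lra.
rewrite leNgt; apply/negP => lt.
have Cp0 : 0 < C1 * p by rewrite mulr_gt0.
move: h; apply/negP; rewrite -ltNge.
apply: (@le_lt_trans _ _ ((C1 * p) ^+ 3)); last first.
  by rewrite ltr_pXn2r// nnegrE ltW// (lt_trans Cp0).
have Dp0 : 0 < D * p by rewrite mulr_gt0.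
rewrite (powRM m (ltW C10) (ltW Dp0)) (powRM m (ltW D0) (ltW p0)).
case: Kal => [->|eal].
  by rewrite mul0r mulr0 exprn_ge0// ltW.
have rp : r ^+ 4 * p `^ m = p ^+ 3.
  rewrite -!powR_mulrn ?ltW// /p -!powRrM -powRD; last first.
    by apply/implyP => _; rewrite gt_eqF.
  by rewrite eal mulrC.
have -> : 27 / 4 * (2 * r) ^+ 4 * (K * (C1 `^ m * (D `^ m * p `^ m))) =
    27 / 4 * 2 ^+ 4 * K * D `^ m * C1 `^ m * (r ^+ 4 * p `^ m).
  rewrite exprMn; move: (C1 `^ m) (D `^ m) (p `^ m) (r ^+ 4) => ? ? ? ?.
  by ring.
by rewrite rp exprMn; apply: ler_wpM2r => //; rewrite exprn_ge0// ltW.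
Qed.

(** * Reduction of the equation *)

Lemma viscosity_supersolution_quartic (R : realType) (n : nat)
    (U : set 'rV[R]_n) (G : 'rV[R]_n -> R -> 'rV[R]_n -> R) (K m : R)
    (u : 'rV[R]_n -> R) :
  (forall x t xi, U x -> `|G x t xi| <= K * `|t| `^ m) ->
  viscosity_supersolution U G u -> quartic_supersolution U K m u.
Proof.
move=> GK su y z c1 c2 q Uz umin.
have qE : radial_quartic y q c1 c2 z = 0.
  by rewrite /radial_quartic -/q subrr expr0n !mulr0 addr0.
rewrite -(@infinity_laplacian_radial_quartic R n y q c1 c2 z)//.
apply: le_trans (su _ z (C2_radial_quartic y q c1 c2 U) Uz _) _.
  by rewrite /local_min /= qE subr0.
exact: le_trans (ler_norm _) (GK _ _ _ Uz).
Qed.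

Lemma viscosity_subsolution_quartic (R : realType) (n : nat)
    (U : set 'rV[R]_n) (G : 'rV[R]_n -> R -> 'rV[R]_n -> R) (K m : R)
    (u : 'rV[R]_n -> R) :
  (forall x t xi, U x -> `|G x t xi| <= K * `|t| `^ m) ->
  viscosity_subsolution U G u -> quartic_supersolution U K m (\- u).
Proof.
move=> GK su y z c1 c2 q Uz umin.
have qE : radial_quartic y q (- c1) (- c2) z = 0.
  by rewrite /radial_quartic -/q subrr expr0n !mulr0 addr0.
have := su _ z (C2_radial_quartic y q (- c1) (- c2) U) Uz.
rewrite infinity_laplacian_radial_quartic// => h.
have {}h : G z (u z) (gradient (radial_quartic y q (- c1) (- c2)) z) <=
    4 * (- c1) ^+ 2 * q * (2 * - c1 + 8 * - c2 * q).
  apply: h; apply: filterS umin => x.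
  by rewrite /= qE subr0 /radial_quartic; lra.
have := GK z (u z) (gradient (radial_quartic y q (- c1) (- c2)) z) Uz.
rewrite ler_norml => /andP[/le_trans/(_ h) + _].
by rewrite sqrrN normrN; lra.
Qed.

(** Rescaling the gradient variable, [xi = s (xi / s)], trades the factor
[min 1 (enorm xi)^kappa] for the full power [s^kappa]. *)
Lemma growth_condition_powR (R : realType) (n : nat) (U : set 'rV[R]_n)
    (Cstar m kappa F : R) (f : 'rV[R]_n -> R)
    (G : 'rV[R]_n -> R -> 'rV[R]_n -> R) :
  0 <= Cstar -> (forall x, U x -> `|f x| <= F) ->
  growth_condition U Cstar m kappa f G ->
  forall s x t xi, 0 < s <= 1 -> U x ->
    `|G x t xi| <= s `^ kappa * (Cstar * F * `|t| `^ m).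
Proof.
move=> C0 fF hG s x t xi s01 Ux.
have /andP[s0 _] := s01.
have := hG 1 s x t (s^-1 *: xi); rewrite ltr01 lexx => /(_ isT s01 Ux).
rewrite mul1r scalerA divff ?gt_eqF// scale1r powR1 mulr1 => /le_trans; apply.
have -> : s `^ kappa * (Cstar * F * `|t| `^ m) =
  Cstar * s `^ kappa * F * `|t| `^ m * 1 by ring.
apply: ler_pM => //.
- by rewrite !mulr_ge0// powR_ge0.
- by rewrite le_min ler01 powR_ge0.
apply: ler_wpM2r; first exact: powR_ge0.
by apply: ler_wpM2l; [rewrite mulr_ge0// powR_ge0|exact: fF].
Qed.

(** The bound [growth_condition_powR] holds for arbitrarily small s, and its
right-hand side tends to 0 with s. *)
Lemma growth_condition_kappa_gt0 (R : realType) (n : nat) (U : set 'rV[R]_n)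
    (Cstar m kappa F : R) (f : 'rV[R]_n -> R)
    (G : 'rV[R]_n -> R -> 'rV[R]_n -> R) :
  0 <= Cstar -> (forall x, U x -> `|f x| <= F) -> 0 < kappa ->
  growth_condition U Cstar m kappa f G ->
  forall x t xi, U x -> G x t xi = 0.
Proof.
move=> C0 fF k0 hG x t xi Ux.
have bound s := @growth_condition_powR _ _ _ _ _ _ _ _ _ C0 fF hG s x t xi.
set B := Cstar * F * _ in bound.
have B0 : 0 <= B.
  by rewrite !mulr_ge0// ?powR_ge0//; exact: le_trans (fF _ Ux).
apply/normr0_eq0/eqP; rewrite eq_le normr_ge0 andbT.
apply/ler_addgt0Pr => e e0; rewrite add0r.
pose t0 := Num.min 1 (e / (B + 1)).
have t00 : 0 < t0 by rewrite lt_min ltr01 divr_gt0// ltr_wpDl.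
have t01 : t0 <= 1 by rewrite ge_min lexx.
have s01 : 0 < t0 `^ kappa^-1 <= 1.
  have e1 : (1 : R) `^ kappa^-1 = 1 by rewrite powR1.
  rewrite powR_gt0//= -[leRHS]e1.
  by apply: powR_le_base (ltW t00) t01; rewrite invr_ge0 ltW.
have := bound _ s01 Ux.
rewrite -powRrM mulVf ?gt_eqF// powRr1 ?(ltW t00)// => /le_trans; apply.
apply: (@le_trans _ _ (e / (B + 1) * B)).
  by apply: ler_wpM2r => //; rewrite ge_min lexx orbT.
by rewrite mulrAC ler_pdivrMr ?ltr_wpDl//; nra.
Qed.

(** * One-sided control at a branching point *)

Theorem theorem1p4 (R : realType) (n : nat) (hn : (0 < n)%N)
    (Cstar m kappa : R) (f : 'rV[R]_n -> R)
    (G : 'rV[R]_n -> R -> 'rV[R]_n -> R) (u : 'rV[R]_n -> R)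
    (hCstar : 0 < Cstar)
    (hm : 0 <= m < 3) (hkappa : 0 <= kappa < 4) (hmkappa : m < 3 - kappa)
    (hf_cont : {within eball 0 1, continuous f})
    (hf_bdd : (Linfty_norm (eball 0 1) f < +oo)%E)
    (hG : growth_condition (eball 0 1) Cstar m kappa f G)
    (hu_cont : {within eball 0 1, continuous u})
    (hu_sol : viscosity_solution (eball 0 1) G u)
    (hu_bdd : (Linfty_norm (eball 0 1) u <= 1)%E)
    (x0 : 'rV[R]_n) (hx0 : branching_points (eball 0 1) u x0)
    (r0 : R) (hr0 : 0 < r0) (hball : eball x0 r0 `<=` eball 0 1)
    (C0 : R) (hC0 : 0 < C0) :
  let alpha : R := (4 - kappa) / (3 - (m + kappa)) in
  ((forall r : R, 0 < r <= r0 ->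
      (sup_on (eball x0 r) (u^\-)%R <= (C0 * r `^ alpha)%:E)%E) ->
   exists C1 : R, 0 < C1 /\
     forall r : R, 0 < r <= r0 ->
       (sup_on (eball x0 r) (u^\+)%R <= (C1 * r `^ alpha)%:E)%E) /\
  ((forall r : R, 0 < r <= r0 ->
      (sup_on (eball x0 r) (u^\+)%R <= (C0 * r `^ alpha)%:E)%E) ->
   exists C1 : R, 0 < C1 /\
     forall r : R, 0 < r <= r0 ->
       (sup_on (eball x0 r) (u^\-)%R <= (C1 * r `^ alpha)%:E)%E).
Proof.
move=> alpha.
have /andP[k0 k4] := hkappa; have /andP[m0 m3] := hm.
have den : 0 < 3 - (m + kappa) by lra.
have al0 : 0 <= alpha by rewrite divr_ge0 ?ltW//; lra.
have u1 x : eball 0 1 x -> `|u x| <= 1.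
  move=> Ux; rewrite -lee_fin; apply: le_trans hu_bdd.
  by apply: ereal_sup_ubound; exists x.
have [F fF] : exists F : R, forall x, eball 0 1 x -> `|f x| <= F.
  move: hf_bdd; rewrite /Linfty_norm /sup_on; set S := ereal_sup _ => Soo.
  have Sf x : eball 0 1 x -> (`|f x|%:E <= S)%E.
    by move=> Ux; apply: ereal_sup_ubound; exists x.
  case: S Soo Sf => [F|//|] _ Sf; first by exists F => x /Sf; rewrite lee_fin.
  by exists 0 => x /Sf; rewrite leeNy_eq.
have ux0 : u x0 = 0 by case: hx0 => -[[]].
have Ux0 : eball 0 1 x0 by case: hx0 => -[[]].
have F0 : 0 <= F := le_trans (normr_ge0 _) (fF _ Ux0).
have [K [K0 GK Kal]] : exists K : R, [/\ 0 <= K,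
    forall x t xi, eball 0 1 x -> `|G x t xi| <= K * `|t| `^ m &
    K = 0 \/ 4 + alpha * m = 3 * alpha].
  have [k_gt0|k_le0] := ltP 0 kappa.
    exists 0; split=> [//|x t xi Ux|]; last by left.
    by rewrite (growth_condition_kappa_gt0 (ltW hCstar) fF k_gt0 hG)// normr0 mul0r.
  have kE : kappa = 0 by apply/le_anti; rewrite k_le0.
  exists (Cstar * F); split=> [|x t xi Ux|]; first by rewrite mulr_ge0// ltW.
    have := growth_condition_powR (ltW hCstar) fF hG (s := 1) t xi _ Ux.
    by rewrite powR1 mul1r ltr01 lexx; exact.
  by right; rewrite /alpha kE; field; rewrite gt_eqF//; lra.
have sup_le (w : 'rV[R]_n -> R) (r c : R) : 0 <= c ->
    (forall x, eball x0 r x -> w x <= c) ->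
    (sup_on (eball x0 r) (fun x => Num.max (w x) 0%R) <= c%:E)%E.
  move=> c0 wc; apply: ge_ereal_sup => _ [x xr <-].
  by rewrite lee_fin ge_max wc.
have le_sup (w : 'rV[R]_n -> R) (r c : R) :
    (sup_on (eball x0 r) (fun x => Num.max (w x) 0%R) <= c%:E)%E ->
    forall x, eball x0 r x -> w x <= c.
  move=> wc x xr.
  have : ((Num.max (w x) 0%R)%:E <= c%:E)%E.
    by apply: le_trans wc; apply: ereal_sup_ubound; exists x.
  by rewrite lee_fin ge_max => /andP[].
split=> bound.
  have [|C1 [C10 C1P]] := one_sided_growth (x0 := x0)
    (viscosity_supersolution_quartic GK hu_sol.2)
    hu_cont hm K0 al0 Kal hr0 hball ux0 u1 hC0.
    by move=> r rr x xr; rewrite lerNl; exact: (le_sup _ _ _ (bound r rr)).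
  exists C1; split=> // r rr; apply: (sup_le u) => [|x xr].
    by rewrite mulr_ge0 ?powR_ge0// ltW.
  exact: C1P.
have Nu_cont : {within eball 0 1, continuous (\- u)}.
  by move=> x; exact: (continuousN (hu_cont x)).
have Nux0 : (\- u) x0 = 0 by rewrite /= ux0 oppr0.
have Nu1 x : eball 0 1 x -> `|(\- u) x| <= 1 by move=> Ux; rewrite /= normrN u1.
have [|C1 [C10 C1P]] := one_sided_growth (x0 := x0)
  (viscosity_subsolution_quartic GK hu_sol.1)
  Nu_cont hm K0 al0 Kal hr0 hball Nux0 Nu1 hC0.
  by move=> r rr x xr; rewrite lerN2; exact: (le_sup _ _ _ (bound r rr)).
exists C1; split=> // r rr; apply: (sup_le (\- u)) => [|x xr].
  by rewrite mulr_ge0 ?powR_ge0// ltW.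
exact: C1P.
Qed.
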